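(* Let $(\mathfrak a,\alpha,\beta)$ be a multiplicative Hom-Lie antialgebra and let $\phi=(\phi_0,\phi_1)$ be a Nijenhuis operator on $\mathfrak a$. Then a deformation of $\mathfrak a$ can be obtained by putting $$\omega_0(x_1,x_2)=x_1\cdot\phi_0(x_2)+\phi_0(x_1)\cdot x_2-\phi_0(x_1\cdot x_2),$$ $$\omega_1(x_1,y_1)=x_1\cdot\phi_1(y_1)+\phi_0(x_1)\cdot y_1-\phi_1(x_1\cdot y_1),$$ $$\omega_2(y_1,y_2)=[y_1,\phi_1(y_2)]+[\phi_1(y_1),y_2]-\phi_0([y_1,y_2])$$ for $x_1,x_2\in\mathfrak a_0$, $y_1,y_2\in\mathfrak a_1$; that is, $(\omega_0,\omega_1,\omega_2)$ generates a $t$-parameter infinitesimal deformation of $(\mathfrak a,\alpha,\beta)$. Furthermore, this deformation is trivial.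
   Context: The base field is algebraically closed of characteristic $0$. A Hom-Lie antialgebra $(\mathfrak a,\alpha,\beta)$ is a $\mathbb Z_2$-graded algebra $\mathfrak a=\mathfrak a_0\oplus\mathfrak a_1$, $\mathfrak a_i\cdot\mathfrak a_j\subset\mathfrak a_{i+j}$, which is supercommutative ($x\cdot x'=x'\cdot x$, $x\cdot y=y\cdot x$ for $x,x'\in\mathfrak a_0$, $y\in\mathfrak a_1$, and the product of odd elements, written $[y,y']$, satisfies $[y,y']=-[y',y]$), with linear maps $\alpha:\mathfrak a_0\to\mathfrak a_0$, $\beta:\mathfrak a_1\to\mathfrak a_1$ such that for all $x_i\in\mathfrak a_0$, $y_i\in\mathfrak a_1$: (1) $\alpha(x_1)\cdot(x_2\cdot x_3)=(x_1\cdot x_2)\cdot\alpha(x_3)$; (2) $\alpha(x_1)\cdot(x_2\cdot y_1)=\frac12(x_1\cdot x_2)\cdot\beta(y_1)$; (3) $\alpha(x_1)\cdot[y_1,y_2]=[x_1\cdot y_1,\beta(y_2)]+[\beta(y_1),x_1\cdot y_2]$; (4) $\beta(y_1)\cdot[y_2,y_3]+\beta(y_2)\cdot[y_3,y_1]+\beta(y_3)\cdot[y_1,y_2]=0$. It is multiplicative if $\alpha(x_1\cdot x_2)=\alpha(x_1)\cdot\alpha(x_2)$, $\beta(x_1\cdot y_1)=\alpha(x_1)\cdot\beta(y_1)$, $\alpha([y_1,y_2])=[\beta(y_1),\beta(y_2)]$. All Hom-Lie antialgebras are assumed multiplicative. **Nijenhuis operator.** A pair of linear maps $\phi_0:\mathfrak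 a_0\to\mathfrak a_0$, $\phi_1:\mathfrak a_1\to\mathfrak a_1$ is a Nijenhuis operator if, for all $x,x_i\in\mathfrak a_0$, $y,y_i\in\mathfrak a_1$, $\phi_0\circ\alpha=\alpha\circ\phi_0$, $\phi_1\circ\beta=\beta\circ\phi_1$, $\phi_0(x_1\cdot\phi_0(x_2))+\phi_0(\phi_0(x_1)\cdot x_2)-\phi_0^2(x_1\cdot x_2)=\phi_0(x_1)\cdot\phi_0(x_2)$, $\phi_1(x\cdot\phi_1(y))+\phi_1(\phi_0(x)\cdot y)-\phi_1^2(x\cdot y)=\phi_0(x)\cdot\phi_1(y)$, $\phi_0([y_1,\phi_1(y_2)])+\phi_0([\phi_1(y_1),y_2])-\phi_0^2([y_1,y_2])=[\phi_1(y_1),\phi_1(y_2)]$. **Deformation.** For bilinear maps $\omega_0:\mathfrak a_0\times\mathfrak a_0\to\mathfrak a_0$, $\omega_1:\mathfrak a_0\times\mathfrak a_1\to\mathfrak a_1$, $\omega_2:\mathfrak a_1\times\mathfrak a_1\to\mathfrak a_0$ put $x_1\cdot_t x_2=x_1\cdot x_2+t\,\omega_0(x_1,x_2)$, $x_1\cdot_t y_1=x_1\cdot y_1+t\,\omega_1(x_1,y_1)$, $[y_1,y_2]_t=[y_1,y_2]+t\,\omega_2(y_1,y_2)$. $\omega=(\omega_0,\omega_1,\omega_2)$ generates a $t$-parameter infinitesimal deformation of $(\mathfrak a,\alpha,\beta)$ if these operations make $\mathfrak a$, with the maps $\alpha,\beta$, a multiplicative Hom-Lie antialgebra, denoted $(\mathfrak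 a_t,\alpha,\beta)$ (for all values of $t$). **Trivial deformation.** The deformation is trivial if there are linear maps $\psi_0:\mathfrak a_0\to\mathfrak a_0$, $\psi_1:\mathfrak a_1\to\mathfrak a_1$ such that, with $\psi_{0t}=\mathrm{id}_{\mathfrak a_0}+t\psi_0$, $\psi_{1t}=\mathrm{id}_{\mathfrak a_1}+t\psi_1$, the pair $(\psi_{0t},\psi_{1t})$ is a Hom-Lie antialgebra homomorphism from $\mathfrak a_t$ to $\mathfrak a$, i.e. $\psi_{0t}\circ\alpha=\alpha\circ\psi_{0t}$, $\psi_{1t}\circ\beta=\beta\circ\psi_{1t}$, $\psi_{0t}(x_1\cdot_t x_2)=\psi_{0t}(x_1)\cdot\psi_{0t}(x_2)$, $\psi_{1t}(x_1\cdot_t y_1)=\psi_{0t}(x_1)\cdot\psi_{1t}(y_1)$, $\psi_{0t}([y_1,y_2]_t)=[\psi_{1t}(y_1),\psi_{1t}(y_2)]$. *)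

(* Defs.v *)
From HB Require Import structures.
From mathcomp Require Import all_boot all_order all_algebra.

Set Implicit Arguments.
Unset Strict Implicit.
Unset Printing Implicit Defensive.

Import GRing.Theory.
Local Open Scope ring_scope.

Definition bilinear_op (K : fieldType) (U V W : lmodType K)
    (f : U -> V -> W) : Prop :=
  (forall v, linear (f^~ v)) /\ (forall u, linear (f u)).

(* The product of a Z_2-graded algebra a0 (+) a1, given by its four components;
   their types express a_i . a_j \subset a_(i+j). *)
Record graded_product (K : fieldType) (a0 a1 : lmodType K) := GradedProduct {
  mul00 : a0 -> a0 -> a0;
  mul01 : a0 -> a1 -> a1;
  mul10 : a1 -> a0 -> a1;
  mul11 : a1 -> a1 -> a0
}.

Record is_graded_algebra (K : fieldType) (a0 a1 : lmodType K)
    (m : graded_product a0 a1) : Prop := {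
  mul00_bilinear : bilinear_op (mul00 m);
  mul01_bilinear : bilinear_op (mul01 m);
  mul10_bilinear : bilinear_op (mul10 m);
  mul11_bilinear : bilinear_op (mul11 m)
}.

Record supercommutative (K : fieldType) (a0 a1 : lmodType K)
    (m : graded_product a0 a1) : Prop := {
  mul00C : forall x x', mul00 m x x' = mul00 m x' x;
  mul01C : forall x y, mul01 m x y = mul10 m y x;
  mul11N : forall y y', mul11 m y y' = - mul11 m y' y
}.

Record hom_lie_antialgebra (K : fieldType) (a0 a1 : lmodType K)
    (m : graded_product a0 a1)
    (alpha : {linear a0 -> a0}) (beta : {linear a1 -> a1}) : Prop := {
  hla_graded : is_graded_algebra m;
  hla_supercomm : supercommutative m;
  hla_assoc : forall x1 x2 x3,
    mul00 m (alpha x1) (mul00 m x2 x3) = mul00 m (mul00 m x1 x2) (alpha x3);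
  hla_half_action : forall x1 x2 y1,
    mul01 m (alpha x1) (mul01 m x2 y1)
      = 2^-1 *: mul01 m (mul00 m x1 x2) (beta y1);
  hla_leibniz : forall x1 y1 y2,
    mul00 m (alpha x1) (mul11 m y1 y2)
      = mul11 m (mul01 m x1 y1) (beta y2) + mul11 m (beta y1) (mul01 m x1 y2);
  hla_jacobi : forall y1 y2 y3,
    mul10 m (beta y1) (mul11 m y2 y3) + mul10 m (beta y2) (mul11 m y3 y1)
      + mul10 m (beta y3) (mul11 m y1 y2) = 0
}.

Record multiplicative_hom_lie_antialgebra (K : fieldType)
    (a0 a1 : lmodType K) (m : graded_product a0 a1)
    (alpha : {linear a0 -> a0}) (beta : {linear a1 -> a1}) : Prop := {
  mhla_hla : hom_lie_antialgebra m alpha beta;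
  mhla_mul00 : forall x1 x2,
    alpha (mul00 m x1 x2) = mul00 m (alpha x1) (alpha x2);
  mhla_mul01 : forall x1 y1,
    beta (mul01 m x1 y1) = mul01 m (alpha x1) (beta y1);
  mhla_mul11 : forall y1 y2,
    alpha (mul11 m y1 y2) = mul11 m (beta y1) (beta y2)
}.

Record nijenhuis_operator (K : fieldType) (a0 a1 : lmodType K)
    (m : graded_product a0 a1)
    (alpha : {linear a0 -> a0}) (beta : {linear a1 -> a1})
    (phi0 : {linear a0 -> a0}) (phi1 : {linear a1 -> a1}) : Prop := {
  nij_alpha : forall x, phi0 (alpha x) = alpha (phi0 x);
  nij_beta : forall y, phi1 (beta y) = beta (phi1 y);
  nij_mul00 : forall x1 x2,
    phi0 (mul00 m x1 (phi0 x2)) + phi0 (mul00 m (phi0 x1) x2)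
      - phi0 (phi0 (mul00 m x1 x2)) = mul00 m (phi0 x1) (phi0 x2);
  nij_mul01 : forall x y,
    phi1 (mul01 m x (phi1 y)) + phi1 (mul01 m (phi0 x) y)
      - phi1 (phi1 (mul01 m x y)) = mul01 m (phi0 x) (phi1 y);
  nij_mul11 : forall y1 y2,
    phi0 (mul11 m y1 (phi1 y2)) + phi0 (mul11 m (phi1 y1) y2)
      - phi0 (phi0 (mul11 m y1 y2)) = mul11 m (phi1 y1) (phi1 y2)
}.

(* w1 deforms both a0 x a1 -> a1 and a1 x a0 -> a1, since x . y = y . x. *)
Definition deformed_product (K : fieldType) (a0 a1 : lmodType K)
    (m : graded_product a0 a1) (w0 : a0 -> a0 -> a0)
    (w1 : a0 -> a1 -> a1) (w2 : a1 -> a1 -> a0) (t : K) :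
    graded_product a0 a1 :=
  GradedProduct
    (fun x1 x2 => mul00 m x1 x2 + t *: w0 x1 x2)
    (fun x y => mul01 m x y + t *: w1 x y)
    (fun y x => mul10 m y x + t *: w1 x y)
    (fun y1 y2 => mul11 m y1 y2 + t *: w2 y1 y2).

Definition generates_deformation (K : fieldType) (a0 a1 : lmodType K)
    (m : graded_product a0 a1)
    (alpha : {linear a0 -> a0}) (beta : {linear a1 -> a1})
    (w0 : a0 -> a0 -> a0) (w1 : a0 -> a1 -> a1) (w2 : a1 -> a1 -> a0) : Prop :=
  [/\ bilinear_op w0, bilinear_op w1, bilinear_op w2 &
      forall t : K, multiplicative_hom_lie_antialgebra
                      (deformed_product m w0 w1 w2 t) alpha beta].

(* Homomorphism from (m, alpha, beta) to (m', alpha', beta'); compatibility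
   with mul10 follows from supercommutativity. *)
Record hom_lie_antialgebra_hom (K : fieldType) (a0 a1 b0 b1 : lmodType K)
    (m : graded_product a0 a1)
    (alpha : {linear a0 -> a0}) (beta : {linear a1 -> a1})
    (m' : graded_product b0 b1)
    (alpha' : {linear b0 -> b0}) (beta' : {linear b1 -> b1})
    (f0 : {linear a0 -> b0}) (f1 : {linear a1 -> b1}) : Prop := {
  hom_alpha : forall x, f0 (alpha x) = alpha' (f0 x);
  hom_beta : forall y, f1 (beta y) = beta' (f1 y);
  hom_mul00 : forall x1 x2, f0 (mul00 m x1 x2) = mul00 m' (f0 x1) (f0 x2);
  hom_mul01 : forall x y, f1 (mul01 m x y) = mul01 m' (f0 x) (f1 y);
  hom_mul11 : forall y1 y2, f0 (mul11 m y1 y2) = mul11 m' (f1 y1) (f1 y2)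
}.

Definition trivial_deformation (K : fieldType) (a0 a1 : lmodType K)
    (m : graded_product a0 a1)
    (alpha : {linear a0 -> a0}) (beta : {linear a1 -> a1})
    (w0 : a0 -> a0 -> a0) (w1 : a0 -> a1 -> a1) (w2 : a1 -> a1 -> a0) : Prop :=
  exists (psi0 : {linear a0 -> a0}) (psi1 : {linear a1 -> a1}),
    forall t : K,
      hom_lie_antialgebra_hom
        (deformed_product m w0 w1 w2 t) alpha beta m alpha beta
        (idfun \+ (t \*: psi0)) (idfun \+ (t \*: psi1)).

(* Main.v *)
Require Import Defs.
From HB Require Import structures.
From mathcomp Require Import all_boot all_order all_algebra.

Set Implicit Arguments.
Unset Strict Implicit.
Unset Printing Implicit Defensive.

Import GRing.Theory.
Local Open Scope ring_scope.

(** Put [F_t = id + t phi].  The Nijenhuis identities say precisely that [F_t]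
    carries the deformed product [m_t] to [m] ([nijenhuis_deform_hom]); this is
    already the triviality of the deformation.

    If every [F_t] were injective, the axioms of a Hom-Lie antialgebra would
    pull back along [F_t], but [id + t phi] may fail to be injective when
    [- t^-1] is an eigenvalue of [phi].  The remedy is to let [t] vary.  For
    fixed arguments, the difference [J_t] of the two sides of an axiom for
    [m_t] is a polynomial [a + t b + t^2 c] in [t], because an axiom composes
    two products, each affine in [t], and [alpha], [beta] do not depend on [t].
    Since [F_t] is multiplicative and commutes with [alpha] and [beta],
    [F_t J_t] is the same difference for [m], taken at the images of the
    arguments under [F_t], hence zero, for every [t].  So the coefficients
    [a], [b + phi a], [c + phi b], [phi c] of the cubic [F_t J_t] all vanish,
    and [a = b = c = 0] follows from the lowest coefficient upwards
    ([quadratic_twist_eq0]): [id + t phi] is always injective on polynomials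
    in [t].  In characteristic zero, the values of a cubic at four points
    determine its coefficients. *)

(** * Polynomials in the deformation parameter *)

Section QuadraticFunctions.

Variables (K : fieldType) (V : lmodType K).

Definition affine (f : K -> V) := exists a b, forall t, f t = a + t *: b.

Definition quadratic (f : K -> V) :=
  exists a b c, forall t, f t = a + t *: b + t ^+ 2 *: c.

Lemma quadraticD f g :
  quadratic f -> quadratic g -> quadratic (fun t => f t + g t).
Proof.
move=> [a [b [c fE]]] [a' [b' [c' gE]]].
exists (a + a'), (b + b'), (c + c') => t.
by rewrite fE gE !scalerDr addrACA (addrACA a).
Qed.

Lemma quadraticZ k f : quadratic f -> quadratic (fun t => k *: f t).
Proof.
move=> [a [b [c fE]]]; exists (k *: a), (k *: b), (k *: c) => t.
by rewrite fE !scalerDr !scalerA ![k * _]mulrC.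
Qed.

Lemma quadraticB f g :
  quadratic f -> quadratic g -> quadratic (fun t => f t - g t).
Proof.
move=> qf /(quadraticZ (-1)) /(quadraticD qf) [a [b [c E]]].
by exists a, b, c => t; rewrite -E scaleN1r.
Qed.

(** Evaluation at [0, 1, -1, 2]: the determinant of this Vandermonde system
    is a unit as soon as [2] and [3] are. *)
Lemma cubic_coef_eq0 (a b c d : V) :
    2 != 0 :> K -> 3 != 0 :> K ->
    (forall t : K, a + t *: b + t ^+ 2 *: c + t ^+ 3 *: d = 0) ->
  [/\ a = 0, b = 0, c = 0 & d = 0].
Proof.
move=> nz2 nz3 fE.
have a0 : a = 0 by have := fE 0; rewrite !expr0n !scale0r !addr0.
have E1 : b + c + d = 0 by have := fE 1; rewrite a0 !expr1n !scale1r add0r.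
have EN1 : - b + c - d = 0.
  have := fE (-1).
  by rewrite a0 add0r sqrrN expr1n exprSr sqrrN expr1n mul1r !scaleN1r scale1r.
have c0 : c = 0.
  have : 2 *: c = 0.
    rewrite scaler_nat mulr2n -[RHS](addr0 0) -{1}E1 -EN1.
    by rewrite [b + c + d]addrAC [- b + c - d]addrAC addrACA -opprD subrr add0r.
  by move/eqP; rewrite scaler_eq0 (negPf nz2) => /eqP.
have bN : b = - d by apply/eqP; rewrite -addr_eq0 -E1 c0 addr0.
have d0 : d = 0.
  have := fE 2; rewrite a0 c0 bN add0r scaler0 addr0 scalerN -scaleNr -scalerDl.
  have -> : - 2 + 2 ^+ 3 = 2 * 3 :> K.
    by rewrite -natrX -natrM addrC -natrB.
  by move/eqP; rewrite scaler_eq0 mulf_eq0 (negPf nz2) (negPf nz3) => /eqP.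
by rewrite bN d0 oppr0.
Qed.

(** Injectivity of [id + t phi] on polynomials in [t], whatever [phi] is. *)
Lemma quadratic_twist_eq0 (phi : {linear V -> V}) (f : K -> V) :
    2 != 0 :> K -> 3 != 0 :> K -> quadratic f ->
    (forall t, f t + t *: phi (f t) = 0) ->
  forall t, f t = 0.
Proof.
move=> nz2 nz3 [a [b [c fE]]] Ff t.
have [] := @cubic_coef_eq0 a (b + phi a) (c + phi b) (phi c) nz2 nz3.
  move=> s; rewrite -[RHS](Ff s) fE !linearD !linearZ /= !scalerA.
  by rewrite -expr2 -exprSr !addrA; congr (_ + _ + _); exact: addrAC.
move=> a0; rewrite a0 linear0 addr0 => b0.
rewrite b0 linear0 addr0 => c0 _.
by rewrite fE a0 b0 c0 !scaler0 !addr0.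
Qed.

End QuadraticFunctions.

(** * Deforming one bilinear product *)

Section BilinearOperations.

Variable K : fieldType.
Implicit Types U V W : lmodType K.

Lemma bilinearDl U V W (B : U -> V -> W) (bB : bilinear_op B) u u' v :
  B (u + u') v = B u v + B u' v.
Proof. by have := bB.1 v 1 u u'; rewrite !scale1r. Qed.

Lemma bilinearDr U V W (B : U -> V -> W) (bB : bilinear_op B) u v v' :
  B u (v + v') = B u v + B u v'.
Proof. by have := bB.2 u 1 v v'; rewrite !scale1r. Qed.

Lemma bilinear0l U V W (B : U -> V -> W) (bB : bilinear_op B) v : B 0 v = 0.
Proof. by apply: (addrI (B 0 v)); rewrite -(bilinearDl bB) !addr0. Qed.

Lemma bilinear0r U V W (B : U -> V -> W) (bB : bilinear_op B) u : B u 0 = 0.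
Proof. by apply: (addrI (B u 0)); rewrite -(bilinearDr bB) !addr0. Qed.

Lemma bilinearZl U V W (B : U -> V -> W) (bB : bilinear_op B) k u v :
  B (k *: u) v = k *: B u v.
Proof. by have := bB.1 v k u 0; rewrite (bilinear0l bB) !addr0. Qed.

Lemma bilinearZr U V W (B : U -> V -> W) (bB : bilinear_op B) k u v :
  B u (k *: v) = k *: B u v.
Proof. by have := bB.2 u k v 0; rewrite (bilinear0r bB) !addr0. Qed.

Lemma bilinear_op_flip U V W (B : U -> V -> W) :
  bilinear_op B -> bilinear_op (fun v u => B u v).
Proof. by case. Qed.

Lemma bilinear_opD U V W (B C : U -> V -> W) :
  bilinear_op B -> bilinear_op C -> bilinear_op (fun u v => B u v + C u v).
Proof.
move=> [lB rB] [lC rC]; split=> z k x y /=.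
  by rewrite lB lC scalerDr addrACA.
by rewrite rB rC scalerDr addrACA.
Qed.

Lemma bilinear_op_comp U V W U' V' W' (B : U -> V -> W)
    (f : {linear U' -> U}) (g : {linear V' -> V}) (h : {linear W -> W'}) :
  bilinear_op B -> bilinear_op (fun u v => h (B (f u) (g v))).
Proof. by move=> [lB rB]; split=> z k x y; rewrite linearP ?lB ?rB linearP. Qed.

Lemma bilinear_opZ U V W k (B : U -> V -> W) :
  bilinear_op B -> bilinear_op (fun u v => k *: B u v).
Proof. exact: (bilinear_op_comp idfun idfun ( *:%R k)). Qed.

(** The infinitesimal of the transport of [B] along [id + t f], [id + t g],
    [id + t h]. *)
Definition nijenhuis_deform U V W (B : U -> V -> W)
    (f : U -> U) (g : V -> V) (h : W -> W) u v : W :=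
  B u (g v) + B (f u) v - h (B u v).

Lemma nijenhuis_deform_bilinear U V W (B : U -> V -> W)
    (f : {linear U -> U}) (g : {linear V -> V}) (h : {linear W -> W}) :
  bilinear_op B -> bilinear_op (nijenhuis_deform B f g h).
Proof.
move=> bB; apply: bilinear_opD; last exact: (bilinear_op_comp idfun idfun (\- h)).
by apply: bilinear_opD; [exact: (bilinear_op_comp idfun g idfun)
                        |exact: (bilinear_op_comp f idfun idfun)].
Qed.

(** The terms of degree one in [t] agree by the choice of the infinitesimal;
    those of degree two are the Nijenhuis identity. *)
Lemma nijenhuis_deform_hom U V W (B : U -> V -> W)
    (f : {linear U -> U}) (g : {linear V -> V}) (h : {linear W -> W}) t u v :
    bilinear_op B ->
    h (B u (g v)) + h (B (f u) v) - h (h (B u v)) = B (f u) (g v) ->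
  (idfun \+ (t \*: h)) (B u v + t *: nijenhuis_deform B f g h u v)
    = B ((idfun \+ (t \*: f)) u) ((idfun \+ (t \*: g)) v).
Proof.
move=> bB nij /=; set w := nijenhuis_deform B f g h u v.
have hw : h w = B (f u) (g v) by rewrite linearB linearD.
rewrite !(bilinearDl bB, bilinearDr bB) !(bilinearZl bB, bilinearZr bB).
rewrite (linearD h) (linearZ_LR h) hw /= !scalerDr -!addrA; congr (_ + _).
by rewrite scalerN addKr.
Qed.

(** Multiplicativity of the structure maps survives the deformation because
    they commute with the Nijenhuis operator. *)
Lemma nijenhuis_deform_morph U V W (B : U -> V -> W)
    (f : U -> U) (g : V -> V) (h : W -> W) (p : U -> U) (q : V -> V)
    (r : {linear W -> W}) t u v :
    (forall x, f (p x) = p (f x)) -> (forall x, g (q x) = q (g x)) ->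
    (forall x, h (r x) = r (h x)) ->
    (forall x y, r (B x y) = B (p x) (q y)) ->
  r (B u v + t *: nijenhuis_deform B f g h u v)
    = B (p u) (q v) + t *: nijenhuis_deform B f g h (p u) (q v).
Proof.
move=> fp gq hr rB; rewrite /nijenhuis_deform (linearD r) (linearZ_LR r) /=.
by rewrite (linearB r) (linearD r) -hr !rB fp gq.
Qed.

(** An axiom multiplies a constant with a deformed product: one more deformed
    product raises the degree in [t] from one to two. *)
Lemma quadratic_deformr U V W (B C : U -> V -> W) u (f : K -> V) :
    bilinear_op B -> bilinear_op C -> affine f ->
  quadratic (fun t => B u (f t) + t *: C u (f t)).
Proof.
move=> bB bC [a [b fE]].
exists (B u a), (B u b + C u a), (C u b) => t.
rewrite fE !(bilinearDr bB, bilinearDr bC) (bilinearZr bB) (bilinearZr bC).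
by rewrite !scalerDr scalerA -expr2 !addrA.
Qed.

Lemma quadratic_deforml U V W (B C : U -> V -> W) v (f : K -> U) :
    bilinear_op B -> bilinear_op C -> affine f ->
  quadratic (fun t => B (f t) v + t *: C (f t) v).
Proof.
move=> /bilinear_op_flip bB /bilinear_op_flip bC.
exact: (quadratic_deformr _ bB bC).
Qed.

End BilinearOperations.

(** * The deformed Hom-Lie antialgebra *)

Section NijenhuisDeformation.

Variables (K : fieldType) (nz2 : 2 != 0 :> K) (nz3 : 3 != 0 :> K).
Variables (a0 a1 : lmodType K) (m : graded_product a0 a1).
Variables (alpha : {linear a0 -> a0}) (beta : {linear a1 -> a1}).
Hypothesis Ha : multiplicative_hom_lie_antialgebra m alpha beta.
Variables (phi0 : {linear a0 -> a0}) (phi1 : {linear a1 -> a1}).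
Hypothesis Hphi : nijenhuis_operator m alpha beta phi0 phi1.

Let w0 := nijenhuis_deform (mul00 m) phi0 phi0 phi0.
Let w1 := nijenhuis_deform (mul01 m) phi0 phi1 phi1.
Let w2 := nijenhuis_deform (mul11 m) phi1 phi1 phi0.
Let mt t := deformed_product m w0 w1 w2 t.
Let F0 t : {linear a0 -> a0} := idfun \+ (t \*: phi0).
Let F1 t : {linear a1 -> a1} := idfun \+ (t \*: phi1).

Let hla := mhla_hla Ha.
Let scm := hla_supercomm hla.
Let b00 := mul00_bilinear (hla_graded hla).
Let b01 := mul01_bilinear (hla_graded hla).
Let b10 := mul10_bilinear (hla_graded hla).
Let b11 := mul11_bilinear (hla_graded hla).

Let bw0 : bilinear_op w0. Proof. exact: nijenhuis_deform_bilinear. Qed.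
Let bw1 : bilinear_op w1. Proof. exact: nijenhuis_deform_bilinear. Qed.
Let bw2 : bilinear_op w2. Proof. exact: nijenhuis_deform_bilinear. Qed.

Lemma nijenhuis_hom t :
  hom_lie_antialgebra_hom (mt t) alpha beta m alpha beta (F0 t) (F1 t).
Proof.
split=> [x|y|x x'|x y|y y'] /=.
- by rewrite (nij_alpha Hphi) linearD linearZ.
- by rewrite (nij_beta Hphi) linearD linearZ.
- exact: (nijenhuis_deform_hom t b00 (nij_mul00 Hphi x x')).
- exact: (nijenhuis_deform_hom t b01 (nij_mul01 Hphi x y)).
- exact: (nijenhuis_deform_hom t b11 (nij_mul11 Hphi y y')).
Qed.

Lemma deformed_graded t : is_graded_algebra (mt t).
Proof.
split=> /=; apply: bilinear_opD => //; apply: bilinear_opZ => //.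
exact: bilinear_op_flip.
Qed.

Lemma deformed_supercomm t : supercommutative (mt t).
Proof.
split=> [x x'|x y|y y'] /=.
- rewrite /w0 /nijenhuis_deform (mul00C scm x' x) (mul00C scm x' (phi0 x)).
  by rewrite (mul00C scm (phi0 x') x) [mul00 m (phi0 x) x' + _]addrC.
- by rewrite (mul01C scm).
- rewrite /w2 /nijenhuis_deform (mul11N scm y y') (mul11N scm y (phi1 y')).
  rewrite (mul11N scm (phi1 y) y') linearN /= opprD -scalerN; congr (_ + _ *: _).
  by rewrite !opprD !opprK (addrC (- _)).
Qed.

Let F00 t := hom_mul00 (nijenhuis_hom t).
Let F01 t := hom_mul01 (nijenhuis_hom t).
Let F11 t := hom_mul11 (nijenhuis_hom t).
Let FA t := hom_alpha (nijenhuis_hom t).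
Let FB t := hom_beta (nijenhuis_hom t).

Let F10 t y x : F1 t (mul10 (mt t) y x) = mul10 m (F1 t y) (F0 t x).
Proof. by rewrite -(mul01C (deformed_supercomm t)) F01 (mul01C scm). Qed.

(** Here [f] and [g] are the two sides of an axiom for the deformed product;
    the hypothesis on [F0 t], [F1 t] is that axiom for [m]. *)
Let eq_twist0 (f g : K -> a0) : quadratic f -> quadratic g ->
  (forall t, F0 t (f t) = F0 t (g t)) -> forall t, f t = g t.
Proof.
move=> qf qg Ffg t; apply/eqP; rewrite -subr_eq0; apply/eqP.
apply: (quadratic_twist_eq0 (phi := phi0) nz2 nz3 (quadraticB qf qg)) => {}t.
by rewrite -[LHS]/(F0 t (f t - g t)) linearB Ffg subrr.
Qed.

Let eq_twist1 (f g : K -> a1) : quadratic f -> quadratic g ->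
  (forall t, F1 t (f t) = F1 t (g t)) -> forall t, f t = g t.
Proof.
move=> qf qg Ffg t; apply/eqP; rewrite -subr_eq0; apply/eqP.
apply: (quadratic_twist_eq0 (phi := phi1) nz2 nz3 (quadraticB qf qg)) => {}t.
by rewrite -[LHS]/(F1 t (f t - g t)) linearB Ffg subrr.
Qed.

Let affine_line (V : lmodType K) (u v : V) : affine (fun t => u + t *: v).
Proof. by exists u, v. Qed.

Lemma deformed_hom_lie_antialgebra t : hom_lie_antialgebra (mt t) alpha beta.
Proof.
split.
- exact: deformed_graded.
- exact: deformed_supercomm.
- move=> x1 x2 x3; move: t; apply: eq_twist0 => [||t].
  + exact: (quadratic_deformr _ b00 bw0 (affine_line _ _)).
  + exact: (quadratic_deforml _ b00 bw0 (affine_line _ _)).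
  + by rewrite !F00 !FA (hla_assoc hla).
- move=> x1 x2 y; move: t; apply: eq_twist1 => [||t].
  + exact: (quadratic_deformr _ b01 bw1 (affine_line _ _)).
  + by apply: quadraticZ; exact: (quadratic_deforml _ b01 bw1 (affine_line _ _)).
  + by rewrite (linearZ_LR (F1 t)) !F01 F00 FA FB (hla_half_action hla).
- move=> x y1 y2; move: t; apply: eq_twist0 => [||t].
  + exact: (quadratic_deformr _ b00 bw0 (affine_line _ _)).
  + by apply: quadraticD; [exact: (quadratic_deforml _ b11 bw2 (affine_line _ _))
                          |exact: (quadratic_deformr _ b11 bw2 (affine_line _ _))].
  + by rewrite [RHS](linearD (F0 t)) F00 !F11 !F01 FA !FB (hla_leibniz hla).
- move=> y1 y2 y3; move: t; apply: eq_twist1 => [||t].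
  + have bw1' := bilinear_op_flip bw1.
    by apply: quadraticD; first apply: quadraticD;
       exact: (quadratic_deformr _ b10 bw1' (affine_line _ _)).
  + by exists 0, 0, 0 => t; rewrite !scaler0 !addr0.
  + by rewrite 2!(linearD (F1 t)) !F10 !F11 !FB (hla_jacobi hla) linear0.
Qed.

Lemma nijenhuis_generates_deformation :
  generates_deformation m alpha beta w0 w1 w2.
Proof.
have [nA nB] := (nij_alpha Hphi, nij_beta Hphi).
split=> // t; split; first exact: deformed_hom_lie_antialgebra.
- by move=> x x'; apply: nijenhuis_deform_morph => //; exact: mhla_mul00 Ha.
- by move=> x y; apply: nijenhuis_deform_morph => //; exact: mhla_mul01 Ha.
- by move=> y y'; apply: nijenhuis_deform_morph => //; exact: mhla_mul11 Ha.
Qed.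

End NijenhuisDeformation.

Theorem theorem3 (K : closedFieldType) (charK : [pchar K] =i pred0)
    (a0 a1 : lmodType K) (m : graded_product a0 a1)
    (alpha : {linear a0 -> a0}) (beta : {linear a1 -> a1})
    (Ha : multiplicative_hom_lie_antialgebra m alpha beta)
    (phi0 : {linear a0 -> a0}) (phi1 : {linear a1 -> a1})
    (Hphi : nijenhuis_operator m alpha beta phi0 phi1) :
  let w0 (x1 x2 : a0) : a0 :=
    mul00 m x1 (phi0 x2) + mul00 m (phi0 x1) x2 - phi0 (mul00 m x1 x2) in
  let w1 (x1 : a0) (y1 : a1) : a1 :=
    mul01 m x1 (phi1 y1) + mul01 m (phi0 x1) y1 - phi1 (mul01 m x1 y1) in
  let w2 (y1 y2 : a1) : a0 :=
    mul11 m y1 (phi1 y2) + mul11 m (phi1 y1) y2 - phi0 (mul11 m y1 y2) in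
  generates_deformation m alpha beta w0 w1 w2 /\
  trivial_deformation m alpha beta w0 w1 w2.
Proof.
have natr_neq0 n : n.+1%:R != 0 :> K by rewrite ((pcharf0P K).1 charK).
split; first exact: (nijenhuis_generates_deformation (natr_neq0 1) (natr_neq0 2)).
by exists phi0, phi1 => t; exact: nijenhuis_hom.
Qed.
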